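(* Let $H\in(0,1/2)$ and let $\mathcal{H}^H$ be the Cameron-Martin space associated to fractional Brownian motion on $[0,1]$ with Hurst parameter $H$. For $\alpha\in(0,H)$ and $1/(H+1/2)<q<\infty$ we have the compact embeddings $$\mathcal{H}^H\subset\subset C^{\alpha\text{-H\''older}},\qquad \mathcal{H}^H\subset\subset C^{q\text{-var}}.$$
   Context: Fractional Brownian motion with Hurst parameter $H$ on $[0,1]$ is the centered continuous Gaussian process with covariance $R_H(s,t)=\tfrac12\left(s^{2H}+t^{2H}-|t-s|^{2H}\right)$; its Cameron-Martin space $\mathcal{H}^H$ is the reproducing kernel Hilbert space of $R_H$, with its Hilbert norm. For $q\ge1$ and $h:[0,1]\to\mathbb{R}$, $|h|_{q\text{-var};[0,1]}=\sup\left(\sum_i|h_{t_{i+1}}-h_{t_i}|^q\right)^{1/q}$, the supremum being over all finite partitions $(t_i)$ of $[0,1]$. $C^{q\text{-var}}$ is the space of continuous paths $h:[0,1]\to\mathbb{R}$ with $|h|_{q\text{-var};[0,1]}<\infty$, with norm $\sup_{[0,1]}|h|+|h|_{q\text{-var};[0,1]}$. $C^{\alpha\text{-H\''older}}$ is the space of paths $h:[0,1]\to\mathbb{R}$ with $|h|_{\alpha\text{-H\''older}}=\sup_{0\le s<t\le1}|h_t-h_s|/|t-s|^\alpha<\infty$, with norm $\sup_{[0,1]}|h|+|h|_{\alpha\text{-H\''older}}$. The symbol $\subset\subset$ means compact embedding: the inclusion is well defined and is a compact linear operator. *)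

(* Defs.v *)
From HB Require Import structures.
From mathcomp Require Import all_boot all_order all_algebra.
From mathcomp Require Import all_classical all_reals all_analysis.
From mathcomp Require Import ring lra.

Set Implicit Arguments.
Unset Strict Implicit.
Unset Printing Implicit Defensive.
Import Order.TTheory GRing.Theory Num.Theory.
Import numFieldNormedType.Exports.
Local Open Scope classical_set_scope.
Local Open Scope ring_scope.

Definition compact_operator (R : numFieldType) (V W : normedModType R)
    (f : {linear V -> W}) : Prop :=
  forall A : set V, bounded_set A -> precompact (f @` A).

(* V and W are spaces of functions T -> R, given by their evaluation maps. *)
Definition compactly_embedded (R : numFieldType) (T : Type)
    (V : normedModType R) (evV : V -> T -> R)
    (W : normedModType R) (evW : W -> T -> R) : Prop :=
  exists2 i : {linear V -> W},
    forall v, evW (i v) = evV v & compact_operator i.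

(* A reproducing kernel Hilbert space of K is determined by K up to a unique
   isometry commuting with the evaluations, so it is treated as a structure
   rather than through a particular construction. *)
Record rkhs (R : realType) (T : Type) (K : T -> T -> R) := Rkhs {
  rkhs_space :> completeNormedModType R;
  rkhs_dot : {dot rkhs_space for idfun};
  rkhs_normE : forall f, `|f| ^+ 2 = rkhs_dot f f;
  rkhs_eval : {linear rkhs_space -> (T -> R)};
  rkhs_eval_inj : injective rkhs_eval;
  rkhs_section : T -> rkhs_space;
  rkhs_sectionE : forall t, rkhs_eval (rkhs_section t) = K t;
  rkhs_reproducing : forall f t, rkhs_dot f (rkhs_section t) = rkhs_eval f t
}.

Notation unit_interval R := (set_type `[0%R : R, 1%R]%classic).

Definition fbm_cov (R : realType) (H : R) (s t : unit_interval R) : R :=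
  2^-1 * (\val s `^ (2 * H) + \val t `^ (2 * H)
          - `|\val t - \val s| `^ (2 * H)).

Definition cameron_martin (R : realType) (H : R) := rkhs (@fbm_cov R H).

Section path_norms.
Context {R : realType}.
Implicit Types (h f g : unit_interval R -> R) (s : seq (unit_interval R)).

Definition sup_norm h : \bar R := ereal_sup [set `|h t|%:E | t in setT].

Definition holder_seminorm (alpha : R) h : \bar R :=
  ereal_sup [set (`|h u.2 - h u.1| / `|\val u.2 - \val u.1| `^ alpha)%:E |
             u in [set u : unit_interval R * unit_interval R |
                   \val u.1 < \val u.2]].

Lemma unit_interval0_subproof : (0 : R) \in (`[0%R, 1%R]%classic : set R).
Proof. by rewrite inE /= in_itv /= lexx ler01. Qed.

Definition unit_interval0 : unit_interval R :=
  exist _ 0 unit_interval0_subproof.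

(* As for [itv_partition], the initial point 0 of a partition is left out. *)
Definition unit_partition s : Prop := itv_partition 0 1 (map \val s).

Definition qvariation (q : R) h s : R :=
  let F := h \o nth unit_interval0 (unit_interval0 :: s) in
  (\sum_(0 <= n < size s) `|F n.+1 - F n| `^ q) `^ q^-1.

Definition qvar_seminorm (q : R) h : \bar R :=
  ereal_sup [set (qvariation q h s)%:E | s in unit_partition].

Lemma sup_normP h (M : R) :
  (sup_norm h <= M%:E)%E <-> forall t, `|h t| <= M.
Proof.
split=> [hM t|hM].
  by rewrite -lee_fin; apply: le_trans hM; apply: ereal_sup_ubound; exists t.
by apply: ge_ereal_sup => _ [t _ <-]; rewrite lee_fin.
Qed.

Lemma holder_seminormP (alpha : R) h (M : R) :
  (holder_seminorm alpha h <= M%:E)%E <->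
  forall u t : unit_interval R, \val u < \val t ->
    `|h t - h u| <= M * `|\val t - \val u| `^ alpha.
Proof.
have dpos (u t : unit_interval R) :
    \val u < \val t -> 0 < `|\val t - \val u :> R| `^ alpha.
  by move=> st; rewrite powR_gt0// normr_gt0 subr_eq0 gt_eqF.
split=> [hM u t ut|hM].
  rewrite -ler_pdivrMr ?dpos// -lee_fin; apply: le_trans hM.
  by apply: ereal_sup_ubound; exists (u, t).
apply: ge_ereal_sup => _ [[s t] /= st <-].
by rewrite lee_fin ler_pdivrMr ?dpos//; exact: hM.
Qed.

Lemma qvar_seminormP (q : R) h (M : R) :
  (qvar_seminorm q h <= M%:E)%E <->
  forall s, unit_partition s -> qvariation q h s <= M.
Proof.
split=> [hM s ps|hM].
  by rewrite -lee_fin; apply: le_trans hM; apply: ereal_sup_ubound; exists s.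
by apply: ge_ereal_sup => _ [s ps <-]; rewrite lee_fin; exact: hM.
Qed.


Lemma powR_sum_le (q : R) n (a b : nat -> R) (A B : R) : 1 <= q ->
  0 < A -> 0 < B ->
  (\sum_(0 <= i < n) `|a i| `^ q) `^ q^-1 <= A ->
  (\sum_(0 <= i < n) `|b i| `^ q) `^ q^-1 <= B ->
  (\sum_(0 <= i < n) `|a i + b i| `^ q) `^ q^-1 <= A + B.
Proof.
move=> q1 A0 B0 aA bB.
have q0 : 0 < q by rewrite (lt_le_trans ltr01).
have AB0 : 0 < A + B by rewrite addr_gt0.
have S0 (c : nat -> R) : 0 <= \sum_(0 <= i < n) `|c i| `^ q.
  by rewrite sumr_ge0// => *; exact: powR_ge0.
have powRK (x : R) : 0 <= x -> (x `^ q^-1) `^ q = x.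
  by move=> x0; rewrite -powRrM mulVf ?gt_eqF// powRr1.
have raise (c : nat -> R) C : 0 < C ->
    (\sum_(0 <= i < n) `|c i| `^ q) `^ q^-1 <= C ->
    \sum_(0 <= i < n) (`|c i| / C) `^ q <= 1.
  move=> C0 cC; under eq_bigr do rewrite powRM ?invr_ge0 ?(ltW C0)//.
  rewrite -mulr_suml -ler_pdivlMr; last first.
    by rewrite powR_gt0 ?invr_gt0.
  rewrite mul1r -(powR_inv1 (ltW C0)) -powRrM mulN1r powRN invrK.
  by rewrite -[leLHS]powRK// ge0_ler_powR ?(ltW q0)// nnegrE ?powR_ge0 ?ltW.
pose l := A / (A + B).
have l01 : 0 <= l <= 1.
  apply/andP; split; first by rewrite divr_ge0// ltW.
  by rewrite ler_pdivrMr// mul1r lerDl ltW.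
have l1 : 1 - l = B / (A + B).
  by rewrite /l -{1}(divff (lt0r_neq0 AB0)) -mulrBl addrAC subrr add0r.
have key i : (`|a i + b i| / (A + B)) `^ q <=
    l * (`|a i| / A) `^ q + (1 - l) * (`|b i| / B) `^ q.
  have aA0 : 0 <= `|a i| / A by rewrite divr_ge0// ltW.
  have bB0 : 0 <= `|b i| / B by rewrite divr_ge0// ltW.
  have /andP[l0 l1'] := l01.
  have onem0 : 0 <= 1 - l by rewrite subr_ge0.
  apply: (@le_trans _ _ ((l * (`|a i| / A) + (1 - l) * (`|b i| / B)) `^ q)).
    rewrite ge0_ler_powR ?(ltW q0)// ?nnegrE ?divr_ge0 ?(ltW AB0)//.
      by rewrite addr_ge0// mulr_ge0.
    have -> : l * (`|a i| / A) + (1 - l) * (`|b i| / B) =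
        (`|a i| + `|b i|) / (A + B).
      by rewrite l1 /l; field; rewrite !gt_eqF.
    by rewrite ler_pM2r ?invr_gt0// ler_normD.
  have := @convex_powR R q q1 (Itv01 l0 l1') (`|a i| / A) (`|b i| / B).
  rewrite !inE /= !in_itv /= !andbT => /(_ aA0 bB0).
  by rewrite /conv /=.
have sum1 : \sum_(0 <= i < n) (`|a i + b i| / (A + B)) `^ q <= 1.
  apply: (le_trans (ler_sum _ (fun i _ => key i))).
  rewrite big_split/= -!mulr_sumr.
  have /andP[l0 l1'] := l01.
  rewrite -[leRHS](subrK l) [leRHS]addrC lerD//.
    by rewrite ler_piMr// raise.
  by rewrite ler_piMr ?subr_ge0// raise.
have eqS : \sum_(0 <= i < n) `|a i + b i| `^ q =
    (A + B) `^ q * \sum_(0 <= i < n) (`|a i + b i| / (A + B)) `^ q.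
  rewrite mulr_sumr; apply: eq_bigr => i _.
  by rewrite -powRM ?divr_ge0 ?(ltW AB0)// mulrC divfK// gt_eqF.
have S'0 : 0 <= \sum_(0 <= i < n) (`|a i + b i| / (A + B)) `^ q.
  by rewrite sumr_ge0// => *; exact: powR_ge0.
rewrite eqS powRM ?powR_ge0// -powRrM mulfV ?gt_eqF// powRr1 ?(ltW AB0)//.
rewrite ler_piMr ?(ltW AB0)// (_ : 1 = 1 `^ q^-1); last by rewrite powR1.
by rewrite ge0_ler_powR ?invr_ge0 ?(ltW q0)// nnegrE.
Qed.

Record path_seminorm (Q : (unit_interval R -> R) -> \bar R) : Prop := {
  path_seminorm0 : (Q 0%R <= 0)%E;
  path_seminorm_ge0 : forall h, (0 <= Q h)%E;
  path_seminormD : forall f g A B, (Q f <= A%:E -> Q g <= B%:E ->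
    Q (f + g)%R <= (A + B)%:E)%E;
  path_seminormZ : forall a h M, (Q h <= M%:E ->
    Q (a *: h)%R <= (`|a| * M)%:E)%E
}.

Lemma sup_norm_seminorm : path_seminorm sup_norm.
Proof.
split=> [|h|f g A B|a h M].
- by apply/sup_normP => t; rewrite normr0.
- apply: (@le_trans _ _ `|h unit_interval0|%:E); first by rewrite lee_fin.
  by apply: ereal_sup_ubound; exists unit_interval0.
- move=> /sup_normP fA /sup_normP gB; apply/sup_normP => t.
  by rewrite (le_trans (ler_normD _ _))// lerD.
- move=> /sup_normP hM; apply/sup_normP => t.
  by rewrite normrM ler_wpM2l.
Qed.

Definition unit_interval1 : unit_interval R.
Proof. by exists 1; rewrite inE /= in_itv /= ler01 lexx. Defined.

Lemma holder_seminorm_seminorm (alpha : R) :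
  path_seminorm (holder_seminorm alpha).
Proof.
split=> [|h|f g A B|a h M].
- by apply/holder_seminormP => s t _; rewrite subrr normr0 mul0r.
- have : exists u, (holder_seminorm alpha h >=
      (`|h u.2 - h u.1| / `|\val u.2 - \val u.1| `^ alpha)%:E)%E.
    exists (unit_interval0, unit_interval1); apply: ereal_sup_ubound.
    by exists (unit_interval0, unit_interval1) => //=; exact: ltr01.
  by move=> [u]; apply: le_trans; rewrite lee_fin divr_ge0// powR_ge0.
- move=> /holder_seminormP fA /holder_seminormP gB.
  apply/holder_seminormP => s t st; rewrite /= opprD addrACA.
  by rewrite (le_trans (ler_normD _ _))// mulrDl lerD ?fA ?gB.
- move=> /holder_seminormP hM; apply/holder_seminormP => s t st.
  by rewrite /= -mulrBr normrM -mulrA ler_wpM2l// hM.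
Qed.

Lemma holder_seminorm_sup (alpha : R) h (M : R) : 0 <= alpha -> 0 <= M ->
  (holder_seminorm alpha h <= M%:E)%E ->
  (sup_norm h <= (`|h unit_interval0| + M)%:E)%E.
Proof.
have pow_le1 (x : R) : 0 <= alpha -> 0 <= x -> x <= 1 -> x `^ alpha <= 1.
  move=> a0 x0 x1; rewrite (_ : 1 = 1 `^ alpha); last by rewrite powR1.
  by rewrite ge0_ler_powR// nnegrE.
move=> a0 M0 /holder_seminormP hM; apply/sup_normP => t.
have := set_valP t; rewrite /= in_itv /= => /andP[t0 t1].
move: t0; rewrite le_eqVlt => /predU1P[t0|t0].
  have -> : t = unit_interval0 by apply: val_inj.
  by rewrite lerDl.
rewrite -[h t](subrK (h unit_interval0)) addrC.
rewrite (le_trans (ler_normD _ _))// lerD// (le_trans (hM unit_interval0 t t0))//.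
rewrite ler_piMr// /= subr0 ger0_norm ?(ltW t0)//.
by apply: pow_le1 => //; exact: ltW.
Qed.

Lemma qvar_seminorm_seminorm (q : R) : 1 <= q ->
  path_seminorm (qvar_seminorm q).
Proof.
move=> q1; have q0 : 0 < q by rewrite (lt_le_trans ltr01).
have up1 : unit_partition [:: unit_interval1].
  by split; rewrite /= ?ltr01 ?eqxx.
have ge0 h : (0 <= qvar_seminorm q h)%E.
  apply: (@le_trans _ _ (qvariation q h [:: unit_interval1])%:E).
    by rewrite lee_fin powR_ge0.
  by apply: ereal_sup_ubound; exists [:: unit_interval1].
split=> // [|f g A B fA gB|a h M].
- apply/qvar_seminormP => s _; rewrite /qvariation.
  under eq_bigr do rewrite /= subrr normr0 powR0 ?gt_eqF//.
  by rewrite big1// powR0// gt_eqF// invr_gt0.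
- have A0 : 0 <= A by rewrite -lee_fin (le_trans (ge0 f)).
  have B0 : 0 <= B by rewrite -lee_fin (le_trans (ge0 g)).
  apply/qvar_seminormP => s ps; apply/ler_addgt0Pr => e e0.
  have e20 : 0 < e / 2 by rewrite divr_gt0.
  rewrite [in leRHS](splitr e) addrACA /qvariation.
  under eq_bigr do rewrite /= opprD addrACA.
  apply: powR_sum_le => //.
  + by rewrite ltr_wpDl.
  + by rewrite ltr_wpDl.
  + move/qvar_seminormP : fA => /(_ s ps) fA.
    by rewrite (le_trans fA)// lerDl ltW.
  + move/qvar_seminormP : gB => /(_ s ps) gB.
    by rewrite (le_trans gB)// lerDl ltW.
- move=> /qvar_seminormP hM; apply/qvar_seminormP => s ps; rewrite /qvariation.
  under eq_bigr do rewrite /= -mulrBr normrM powRM//.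
  rewrite -mulr_sumr powRM ?powR_ge0//; last first.
    by rewrite sumr_ge0// => *; exact: powR_ge0.
  rewrite -powRrM mulfV ?gt_eqF// powRr1// ler_wpM2l//.
  exact: hM.
Qed.

Lemma qvar_seminorm_sup (q : R) h (M : R) : 1 <= q -> 0 <= M ->
  (qvar_seminorm q h <= M%:E)%E ->
  (sup_norm h <= (`|h unit_interval0| + M)%:E)%E.
Proof.
move=> q1 M0 /qvar_seminormP hM; apply/sup_normP => t.
have q0 : 0 < q by rewrite (lt_le_trans ltr01).
have powRK (x : R) : 0 <= x -> x = (x `^ q) `^ q^-1.
  by move=> x0; rewrite -powRrM mulfV ?gt_eqF// powRr1.
have first s : `|h t - h unit_interval0| <= qvariation q h (t :: s).
  rewrite /qvariation [size _]/= big_nat_recl//= [leLHS]powRK//.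
  have S0 : 0 <= \sum_(0 <= i < size s)
      `|h (nth unit_interval0 s i) - h (nth unit_interval0 (t :: s) i)| `^ q.
    by rewrite sumr_ge0// => *; exact: powR_ge0.
  rewrite ge0_ler_powR ?nnegrE ?invr_ge0 ?(ltW q0) ?powR_ge0//.
    by rewrite addr_ge0 ?powR_ge0.
  by rewrite lerDl.
suff : `|h t - h unit_interval0| <= M.
  move=> tM; rewrite -[h t](subrK (h unit_interval0)) addrC.
  by rewrite (le_trans (ler_normD _ _))// lerD.
have := set_valP t; rewrite /= in_itv /= => /andP[].
rewrite le_eqVlt => /predU1P[t0 _|t0].
  have -> : t = unit_interval0 by apply: val_inj.
  by rewrite subrr normr0.
rewrite le_eqVlt => /predU1P[t1|t1].
  apply: (le_trans (first [::])); apply: hM; split=> /=; rewrite ?andbT//.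
  exact/eqP.
apply: (le_trans (first [:: unit_interval1])); apply: hM; split=> //=.
by rewrite t0 t1.
Qed.

(* [sup |h|] is finite as soon as [Q h] is, so [fine] truncates nothing on the
   space of paths with [Q h < +oo]. *)
Definition path_norm (Q : (unit_interval R -> R) -> \bar R) h : R :=
  fine (sup_norm h) + fine (Q h).

Section path_norm_lemmas.
Context (Q : (unit_interval R -> R) -> \bar R) (Qsemi : path_seminorm Q)
  (Qsup : forall h M, 0 <= M ->
     (Q h <= M%:E)%E -> (sup_norm h <= (`|h unit_interval0| + M)%:E)%E).

Lemma path_seminorm_ltyP h : (Q h < +oo)%E -> exists M, (Q h <= M%:E)%E.
Proof.
move=> Qh; exists (fine (Q h)); rewrite fineK// ge0_fin_numE//.
exact: path_seminorm_ge0.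
Qed.

Lemma path_seminorm_fineE h : (Q h < +oo)%E -> (fine (Q h))%:E = Q h.
Proof. by move=> Qh; rewrite fineK// ge0_fin_numE// path_seminorm_ge0. Qed.

Lemma path_sup_norm_lty h : (Q h < +oo)%E -> (sup_norm h < +oo)%E.
Proof.
move=> Qh; have Q0 := path_seminorm_ge0 Qsemi h.
apply: (le_lt_trans (Qsup (M := fine (Q h)) _ _)); rewrite ?ltry//.
  exact: fine_ge0.
by rewrite path_seminorm_fineE.
Qed.

Lemma path_sup_norm_fineE h :
  (Q h < +oo)%E -> (fine (sup_norm h))%:E = sup_norm h.
Proof.
move=> /path_sup_norm_lty Sh; rewrite fineK// ge0_fin_numE//.
exact: path_seminorm_ge0 sup_norm_seminorm h.
Qed.

Lemma path_finite_closed :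
  (Q 0%R < +oo)%E /\ forall a f g,
    (Q f < +oo)%E -> (Q g < +oo)%E -> (Q (a *: f + g)%R < +oo)%E.
Proof.
split=> [|a f g /path_seminorm_ltyP[A fA] /path_seminorm_ltyP[B gB]].
  by rewrite (le_lt_trans (path_seminorm0 Qsemi))// ltry.
apply: (@le_lt_trans _ _ (`|a| * A + B)%:E); last exact: ltry.
by apply: path_seminormD => //; exact: path_seminormZ.
Qed.

Lemma path_normD f g : (Q f < +oo)%E -> (Q g < +oo)%E ->
  path_norm Q (f + g) <= path_norm Q f + path_norm Q g.
Proof.
move=> Qf Qg; have Qfg : (Q (f + g)%R < +oo)%E.
  by have := path_finite_closed.2 1 _ _ Qf Qg; rewrite scale1r.
rewrite /path_norm addrACA lerD// -lee_fin.
  rewrite path_sup_norm_fineE//; apply: (path_seminormD sup_norm_seminorm);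
  by rewrite path_sup_norm_fineE.
by rewrite path_seminorm_fineE//; apply: path_seminormD => //;
  rewrite path_seminorm_fineE.
Qed.

Lemma path_normZ_le a f : (Q f < +oo)%E ->
  path_norm Q (a *: f) <= `|a| * path_norm Q f.
Proof.
move=> Qf; have Qaf : (Q (a *: f)%R < +oo)%E.
  by have := path_finite_closed.2 a _ _ Qf path_finite_closed.1; rewrite addr0.
rewrite /path_norm mulrDr lerD// -lee_fin.
  rewrite path_sup_norm_fineE//; apply: (path_seminormZ sup_norm_seminorm);
  by rewrite path_sup_norm_fineE.
by rewrite path_seminorm_fineE//; apply: path_seminormZ => //;
  rewrite path_seminorm_fineE.
Qed.

Lemma path_normZ a f : (Q f < +oo)%E ->
  path_norm Q (a *: f) = `|a| * path_norm Q f.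
Proof.
move=> Qf; apply/eqP; rewrite eq_le path_normZ_le//=.
have [->|a0] := eqVneq a 0.
  rewrite normr0 mul0r /path_norm addr_ge0 ?fine_ge0 ?path_seminorm_ge0//.
  exact: sup_norm_seminorm.
have Qaf : (Q (a *: f)%R < +oo)%E.
  by have := path_finite_closed.2 a _ _ Qf path_finite_closed.1; rewrite addr0.
have := path_normZ_le a^-1 Qaf; rewrite scalerA mulVf// scale1r normfV.
by rewrite ler_pdivlMl ?normr_gt0.
Qed.

Lemma path_norm_eq0 f : (Q f < +oo)%E -> path_norm Q f = 0 -> f = 0.
Proof.
move=> Qf /eqP; have S0 := path_seminorm_ge0 sup_norm_seminorm f.
have Q0 := path_seminorm_ge0 Qsemi f.
rewrite /path_norm paddr_eq0 ?fine_ge0// => /andP[/eqP Sf _].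
apply/funext => t; apply/normr0_eq0/eqP; rewrite eq_le normr_ge0 andbT.
have : (sup_norm f <= 0%:E)%E by rewrite -path_sup_norm_fineE// Sf.
by move/sup_normP; exact.
Qed.

End path_norm_lemmas.

End path_norms.

(* The proofs of [0 <= alpha] and [1 <= q] are recorded in the two predicates
   only so that the norms below are found by inference from the types. *)
Definition holder_pred (R : realType) (alpha : R) of 0 <= alpha :
    {pred unit_interval R -> R} :=
  mem [set h | (holder_seminorm alpha h < +oo)%E].

Definition qvar_pred (R : realType) (q : R) of 1 <= q :
    {pred unit_interval R -> R} :=
  mem [set h | continuous h /\ (qvar_seminorm q h < +oo)%E].

Section holder_path.
Context {R : realType} (alpha : R) (alpha0 : 0 <= alpha).

Record holder_path := HolderPath {
  holder_fun :> unit_interval R -> R;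
  _ : holder_fun \in holder_pred alpha0
}.

HB.instance Definition _ := [isSub for holder_fun].
HB.instance Definition _ := [Choice of holder_path by <:].

Lemma holder_submod_closed : submod_closed (holder_pred alpha0).
Proof.
have [H0 HD] := path_finite_closed (holder_seminorm_seminorm alpha).
by split=> [|a f g]; rewrite !inE//=; exact: HD.
Qed.

HB.instance Definition _ :=
  GRing.isSubmodClosed.Build _ _ (holder_pred alpha0) holder_submod_closed.
HB.instance Definition _ := [SubChoice_isSubLmodule of holder_path by <:].

Let semi := holder_seminorm_seminorm alpha.
Let sup h M := @holder_seminorm_sup R alpha h M alpha0.
Let N (h : holder_path) : R := path_norm (holder_seminorm alpha) h.

Lemma holder_path_lty (h : holder_path) : (holder_seminorm alpha h < +oo)%E.
Proof. by have := valP h; rewrite inE. Qed.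

Let ND f g : N (f + g) <= N f + N g.
Proof. exact: (path_normD semi sup (holder_path_lty f) (holder_path_lty g)). Qed.

Let NZ a f : N (a *: f) = `|a| * N f.
Proof. exact: (path_normZ semi sup a (holder_path_lty f)). Qed.

Let N_eq0 f : N f = 0 -> f = 0.
Proof.
by move=> /(path_norm_eq0 semi sup (holder_path_lty f)) f0; apply: val_inj.
Qed.

HB.instance Definition _ :=
  Lmodule_isNormed.Build R holder_path ND NZ N_eq0.

Lemma holder_path_normE (h : holder_path) :
  `|h| = fine (sup_norm h) + fine (holder_seminorm alpha h).
Proof. by []. Qed.

End holder_path.

Section qvar_path.
Context {R : realType} (q : R) (q1 : 1 <= q).

Record qvar_path := QvarPath {
  qvar_fun :> unit_interval R -> R;
  _ : qvar_fun \in qvar_pred q1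
}.

HB.instance Definition _ := [isSub for qvar_fun].
HB.instance Definition _ := [Choice of qvar_path by <:].

Lemma qvar_submod_closed : submod_closed (qvar_pred q1).
Proof.
have [H0 HD] := path_finite_closed (qvar_seminorm_seminorm q1).
split=> [|a f g /set_mem[cf Qf] /set_mem[cg Qg]]; apply/mem_set.
  by split=> //; exact: (@cst_continuous (unit_interval R) R 0).
split; last exact: HD.
by move=> t; apply: continuousD;
  [apply: continuousZl_tmp; exact: cf|exact: cg].
Qed.

HB.instance Definition _ :=
  GRing.isSubmodClosed.Build _ _ (qvar_pred q1) qvar_submod_closed.
HB.instance Definition _ := [SubChoice_isSubLmodule of qvar_path by <:].

Let semi := qvar_seminorm_seminorm q1.
Let sup h M := @qvar_seminorm_sup R q h M q1.
Let N (h : qvar_path) : R := path_norm (qvar_seminorm q) h.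

Lemma qvar_path_lty (h : qvar_path) : (qvar_seminorm q h < +oo)%E.
Proof. by have /set_mem[] := valP h. Qed.

Let ND f g : N (f + g) <= N f + N g.
Proof. exact: (path_normD semi sup (qvar_path_lty f) (qvar_path_lty g)). Qed.

Let NZ a f : N (a *: f) = `|a| * N f.
Proof. exact: (path_normZ semi sup a (qvar_path_lty f)). Qed.

Let N_eq0 f : N f = 0 -> f = 0.
Proof.
by move=> /(path_norm_eq0 semi sup (qvar_path_lty f)) f0; apply: val_inj.
Qed.

HB.instance Definition _ :=
  Lmodule_isNormed.Build R qvar_path ND NZ N_eq0.

Lemma qvar_path_normE (h : qvar_path) :
  `|h| = fine (sup_norm h) + fine (qvar_seminorm q h).
Proof. by []. Qed.

End qvar_path.

Lemma qvar_exponent_ge1 (R : realType) (H q : R) :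
  0 < H -> H < 1 / 2 -> 1 / (H + 1 / 2) < q -> 1 <= q.
Proof.
move=> H0 H12 Hq; apply/ltW/(le_lt_trans _ Hq).
by rewrite ler_pdivlMr ?addr_gt0 ?divr_gt0// mul1r; lra.
Qed.

(* Main.v *)
Require Import Defs.
From HB Require Import structures.
From mathcomp Require Import all_boot all_order all_algebra.
From mathcomp Require Import all_classical all_reals all_analysis.
From mathcomp Require Import ring lra.
Import Order.TTheory GRing.Theory Num.Theory.
Import numFieldNormedType.Exports.
Local Open Scope classical_set_scope.
Local Open Scope ring_scope.

(** Write [rho] for the covariance of increments.  By Cauchy-Schwarz, a path [f]
    in the ball of radius [sqrt N] of the reproducing kernel space satisfies
    [(sum_i b_i D_i)^2 <= N sum_ij b_i b_j rho_ij] for the increments [D_i] of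
    [f] over arbitrary intervals and arbitrary weights [b_i].  A single interval
    gives the [H]-Hoelder bound.  For a partition with mesh sizes [d_i],
    disjoint increments are negatively correlated when [H < 1/2], so the double
    sum is at most [2 sum_i b_i^2 d_i^(2H)] and Hoelder's inequality bounds the
    variation of [f] at the exponent [1 / (H + 1/2)].  Interpolating both bounds
    with the oscillation of [f] controls the [alpha]-Hoelder and [q]-variation
    norms by a positive power of the sup norm.

    The displayed inequality is closed under pointwise limits, so by Tychonoff
    the paths from [0] satisfying it form a compact set for pointwise
    convergence, which on that set is uniform convergence by equicontinuity,
    hence convergence in the target norm. *)

Lemma concave_powR {R : realType} {p : R} (p01 : 0 < p <= 1) {l x y : R} :
  0 <= l <= 1 -> 0 <= x -> 0 <= y ->
  l * x `^ p + (1 - l) * y `^ p <= (l * x + (1 - l) * y) `^ p.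
Proof.
case/andP: p01 => p0 p1 /andP[l0 l1] x0 y0.
have q1 : 1 <= p^-1 by rewrite invf_ge1.
have powRK (z : R) : 0 <= z -> (z `^ p) `^ p^-1 = z.
  by move=> z0; rewrite -powRrM mulfV ?gt_eqF// powRr1.
have := @convex_powR R p^-1 q1 (Itv01 l0 l1) (x `^ p) (y `^ p).
rewrite !inE /= !in_itv /= !andbT => /(_ (powR_ge0 _ _) (powR_ge0 _ _)).
rewrite /conv /= !powRK// => le_conv.
have {}le_conv : (l * x `^ p + (1 - l) * y `^ p) `^ p^-1 <= l * x + (1 - l) * y.
  exact: le_conv.
have S0 : 0 <= l * x `^ p + (1 - l) * y `^ p.
  by rewrite addr_ge0// mulr_ge0 ?powR_ge0 ?subr_ge0.
rewrite -[leLHS](powRr1 S0) -[X in _ `^ X <= _](mulVf (lt0r_neq0 p0)) powRrM.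
have S1 := le_trans (powR_ge0 _ _) le_conv.
by rewrite ge0_ler_powR ?nnegrE ?powR_ge0 ?(ltW p0).
Qed.

Lemma powR_four_points {R : realType} {p : R} (p01 : 0 < p <= 1) {a b c d : R} :
  0 <= a -> a <= b -> b <= d -> a + d = b + c ->
  a `^ p + d `^ p <= b `^ p + c `^ p.
Proof.
move=> a0 ab bd e; have [ad|ad] := leP d a.
  have ba : b = a by apply/eqP; rewrite eq_le ab (le_trans bd ad).
  by have -> : c = d by [rewrite ba in e; move/addrI : e]; rewrite ba.
have da : 0 < d - a by rewrite subr_gt0.
pose l := (d - b) / (d - a).
have l01 : 0 <= l <= 1.
  apply/andP; split; first by rewrite divr_ge0 ?subr_ge0// ltW.
  by rewrite ler_pdivrMr// mul1r; lra.
have l'01 : 0 <= 1 - l <= 1 by lra.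
have d0 : 0 <= d by lra.
have := lerD (concave_powR p01 l01 a0 d0) (concave_powR p01 l'01 a0 d0).
have -> : l * a + (1 - l) * d = b by rewrite /l; field; rewrite gt_eqF.
have -> : (1 - l) * a + (1 - (1 - l)) * d = c.
  have -> : c = a + d - b by rewrite e; ring.
  by rewrite /l; field; rewrite gt_eqF.
by apply: le_trans; lra.
Qed.

Lemma powR_weighted_AMGM {R : realType} {p : R} (p01 : 0 < p < 1) {a b : R} :
  0 <= a -> 0 <= b -> a `^ (1 - p) * b `^ p <= (1 - p) * a + p * b.
Proof.
move=> a0 b0; case/andP: p01 => p0 p1; have q0 : 0 < 1 - p by rewrite subr_gt0.
have := @conjugate_powR R (a `^ (1 - p)) (b `^ p) (1 - p)^-1 p^-1.
rewrite -!powRrM !mulfV ?gt_eqF// !powRr1// !invrK => /(_ (powR_ge0 _ _)).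
rewrite !invr_gt0 subrK (mulrC a) (mulrC b).
by apply; rewrite ?powR_ge0.
Qed.

Definition increment_cov {R : realType} {T : Type} (K : T -> T -> R)
    (s t u v : T) : R := K t v - K t u - K s v + K s u.

Lemma sum_increment_cov {R : realType} {T : Type} (K : T -> T -> R) (s t : T)
    (tau : nat -> T) n :
  \sum_(i < n) increment_cov K s t (tau i) (tau i.+1) =
  increment_cov K s t (tau 0) (tau n).
Proof.
pose F i := K t (tau i) - K s (tau i).
rewrite (eq_bigr (fun i : 'I_n => F i.+1 - F i)); last first.
  by move=> i _; rewrite /increment_cov /F; ring.
rewrite -(big_mkord xpredT (fun i => F i.+1 - F i)) telescope_sumr//.
by rewrite /increment_cov /F; ring.
Qed.

Section fbm_increments.
Context {R : realType} {H : R} (H_gt0 : 0 < H) (H_le : H <= 1 / 2).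
Implicit Types s t u v : unit_interval R.
Notation rho := (increment_cov (@fbm_cov R H)).

Let H2_itv : 0 < 2 * H <= 1.
Proof. by apply/andP; split; move: H_gt0 H_le; lra. Qed.

Lemma fbm_increment_covE s t u v :
  rho s t u v = 2^-1 * (`|\val t - \val u| `^ (2 * H)
    + `|\val v - \val s| `^ (2 * H) - `|\val v - \val t| `^ (2 * H)
    - `|\val u - \val s| `^ (2 * H)).
Proof. by rewrite /increment_cov /fbm_cov (distrC (\val u) (\val t)); ring. Qed.

Lemma fbm_increment_covC s t u v : rho s t u v = rho u v s t.
Proof.
rewrite !fbm_increment_covE (distrC (\val v) (\val t)).
by rewrite (distrC (\val s) (\val u)); ring.
Qed.

Lemma fbm_increment_var s t : rho s t s t = `|\val t - \val s| `^ (2 * H).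
Proof.
rewrite fbm_increment_covE !subrr normr0 powR0 ?gt_eqF// ?mulr_gt0//.
by field.
Qed.

Lemma fbm_increment_cov_le0 s t u v :
  \val s <= \val t -> \val t <= \val u -> \val u <= \val v -> rho s t u v <= 0.
Proof.
move=> st tu uv; rewrite fbm_increment_covE distrC.
rewrite !ger0_norm ?subr_ge0//; try lra.
rewrite pmulr_rle0 ?invr_gt0// -addrA -opprD subr_le0 [leRHS]addrC.
by apply: (powR_four_points H2_itv); lra.
Qed.

Lemma fbm_increment_cov_ge0 s t u v :
  \val u <= \val s -> \val s <= \val t -> \val t <= \val v -> 0 <= rho s t u v.
Proof.
move=> us st tv; rewrite fbm_increment_covE (distrC (\val u)).
rewrite !ger0_norm ?subr_ge0//; try lra.
rewrite mulr_ge0 ?invr_ge0// -addrA -opprD subr_ge0 addrC.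
have H2_ge0 : 0 <= 2 * H by rewrite mulr_ge0// ltW.
by rewrite lerD// ge0_ler_powR ?nnegrE//; lra.
Qed.

(* For [H <= 1/2] disjoint increments are negatively correlated, so each
   off-diagonal absolute row sum of the covariance matrix is the diagonal entry
   minus a full row sum, and the latter is nonnegative. *)
Lemma fbm_quadratic_form_le (b : nat -> R) (tau : nat -> unit_interval R) n :
  (forall i, (i < n)%N -> \val (tau i) <= \val (tau i.+1)) ->
  \sum_(i < n) \sum_(j < n)
    b i * b j * rho (tau i) (tau i.+1) (tau j) (tau j.+1) <=
  2 * \sum_(i < n) b i ^+ 2 * `|\val (tau i.+1) - \val (tau i)| `^ (2 * H).
Proof.
move=> tauS; pose c (i j : 'I_n) := rho (tau i) (tau i.+1) (tau j) (tau j.+1).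
have tau_le i j : (i <= j <= n)%N -> \val (tau i) <= \val (tau j).
  case/andP=> ij; rewrite -(subnKC ij); elim: (j - i)%N => [|k IHk].
    by rewrite addn0.
  by rewrite addnS => kn; rewrite (le_trans (IHk (ltnW kn)))// tauS.
pose a (i j : 'I_n) := (if i == j then 2 * c i i else 0) - c i j.
have aC i j : a i j = a j i.
  by rewrite /a /c fbm_increment_covC; case: eqVneq => // ->.
have c_le0 (i j : 'I_n) : (i < j)%N -> c i j <= 0.
  move=> ij; apply: fbm_increment_cov_le0;
    rewrite tau_le// ?leqnSn ?ltn_ord ?ij//=.
  by rewrite ltnW.
have le_a (i j : 'I_n) :
    b i * b j * c i j <= 2^-1 * (b i ^+ 2 * a i j) + 2^-1 * (b j ^+ 2 * a i j).
  rewrite /a; case: eqVneq => [<-|ij].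
    by rewrite le_eqVlt; apply/orP; left; apply/eqP; field.
  have cij : c i j <= 0.
    move: ij; rewrite neq_ltn => /orP[/c_le0//|/c_le0].
    by rewrite /c fbm_increment_covC.
  rewrite -subr_ge0.
  have -> : 2^-1 * (b i ^+ 2 * (0 - c i j)) + 2^-1 * (b j ^+ 2 * (0 - c i j))
     - b i * b j * c i j = 2^-1 * ((b i + b j) ^+ 2 * (- c i j)) by field.
  by rewrite mulr_ge0 ?invr_ge0// mulr_ge0 ?sqr_ge0 ?oppr_ge0.
apply: (le_trans (ler_sum _ (fun i _ => ler_sum _ (fun j _ => le_a i j)))).
under eq_bigr do rewrite big_split/= -!mulr_sumr.
rewrite big_split/= -!mulr_sumr.
have -> : \sum_(i < n) \sum_(j < n) b j ^+ 2 * a i j =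
    \sum_(i < n) b i ^+ 2 * \sum_(j < n) a i j.
  rewrite exchange_big/=; apply: eq_bigr => i _.
  by rewrite mulr_sumr; apply: eq_bigr => j _; rewrite aC.
have half2 : 2^-1 + 2^-1 = 1 :> R by field.
rewrite -mulrDl half2 mul1r mulr_sumr.
apply: ler_sum => i _; rewrite mulrCA ler_wpM2l ?sqr_ge0//.
rewrite big_split/= -big_mkcond/= (big_pred1 i) => [|j]; last first.
  by rewrite /= eq_sym.
rewrite sumrN sum_increment_cov.
rewrite {1}/c fbm_increment_var gerBl.
apply: fbm_increment_cov_ge0; rewrite tau_le//=.
- exact: ltnW (ltn_ord i).
- by rewrite leqnSn ltn_ord.
- by rewrite ltn_ord leqnn.
Qed.

End fbm_increments.

Definition cov_bounded {R : realType} {T : Type} (K : T -> T -> R) (N : R)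
    (f : T -> R) : Prop :=
  forall n (b : nat -> R) (u v : nat -> T),
    (\sum_(i < n) b i * (f (v i) - f (u i))) ^+ 2 <=
    N * \sum_(i < n) \sum_(j < n)
          b i * b j * increment_cov K (u i) (v i) (u j) (v j).

Lemma cov_boundedB {R : realType} {T : Type} {K : T -> T -> R} {N : R}
    {f g : T -> R} :
  cov_bounded K N f -> cov_bounded K N g -> cov_bounded K (4 * N) (f - g).
Proof.
move=> fN gN n b u v; have := fN n b u v; have := gN n b u v.
set G := \sum_(i < n) b i * (g _ - _); set F := \sum_(i < n) b i * (f _ - _).
set V := \sum_(i < n) \sum_(j < n) _.
have -> : \sum_(i < n) b i * ((f - g) (v i) - (f - g) (u i)) = F - G.
  rewrite /F /G -sumrB; apply: eq_bigr => i _.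
  by rewrite (_ : (f - g) (v i) = f (v i) - g (v i))//
    (_ : (f - g) (u i) = f (u i) - g (u i))//; ring.
have : 0 <= (F + G) ^+ 2 by rewrite sqr_ge0.
by rewrite sqrrB sqrrD; lra.
Qed.

Section fbm_paths.
Context {R : realType} {H : R} (H_gt0 : 0 < H) (H_lt : H < 1 / 2).
Context {N : R} (N_ge0 : 0 <= N) {f : unit_interval R -> R}
  (fN : cov_bounded (@fbm_cov R H) N f).

Lemma fbm_holder (s t : unit_interval R) :
  `|f t - f s| <= Num.sqrt N * `|\val t - \val s| `^ H.
Proof.
have : (f t - f s) ^+ 2 <= N * `|\val t - \val s| `^ (2 * H).
  have := fN 1 (fun=> 1) (fun=> s) (fun=> t).
  by rewrite !big_ord1 !mul1r fbm_increment_var.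
rewrite (mulrC 2) powRrM powR_mulrn ?powR_ge0// => le_var.
rewrite -[leRHS]ger0_norm ?mulr_ge0 ?sqrtr_ge0 ?powR_ge0//.
by rewrite -ler_sqr ?nnegrE// !real_normK ?num_real// exprMn sqr_sqrtr.
Qed.

(* Testing [cov_bounded] against [b i = sg (D i) |D i|^(q - 1)], where [D i] is
   the [i]-th increment, gives
   [S^2 <= 2 N sum_i (|D i|^q)^(1 - 2H) d_i^(2H)] for the sum [S] below;
   Hoelder's inequality bounds the last sum by [S^(1 - 2H) (sum_i d_i)^(2H)]. *)
Lemma fbm_power_sum_le (tau : nat -> unit_interval R) n :
  (forall i, (i < n)%N -> \val (tau i) <= \val (tau i.+1)) ->
  (\sum_(i < n) `|f (tau i.+1) - f (tau i)| `^ (1 / (H + 1 / 2)))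
    `^ (1 + 2 * H) <= 2 * N.
Proof.
move=> tauS; set q := 1 / (H + 1 / 2).
have H2_gt0 : 0 < 2 * H by rewrite mulr_gt0.
have H2_itv : 0 < 2 * H < 1 by rewrite H2_gt0/=; move: H_lt; lra.
have q_gt0 : 0 < q by rewrite divr_gt0// addr_gt0.
set S := \sum_(i < n) _.
have S_ge0 : 0 <= S by rewrite sumr_ge0// => i _; exact: powR_ge0.
have [S0|S_neq0] := eqVneq S 0.
  by rewrite S0 powR0 ?mulr_ge0// gt_eqF// addr_gt0.
have S_gt0 : 0 < S by rewrite lt_neqAle eq_sym S_neq0.
pose D i := f (tau i.+1) - f (tau i).
pose d i := `|\val (tau i.+1) - \val (tau i)|.
pose b i := Num.sg (D i) * `|D i| `^ (q - 1).
have sum_d : \sum_(i < n) d i <= 1.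
  rewrite (eq_bigr (fun i : 'I_n => \val (tau i.+1) - \val (tau i)));
    last first.
    by move=> i _; rewrite /d ger0_norm// subr_ge0 tauS.
  rewrite -(big_mkord xpredT (fun i => \val (tau i.+1) - \val (tau i))).
  rewrite telescope_sumr//.
  have := set_valP (tau 0%N); have := set_valP (tau n).
  by rewrite /= !in_itv/=; lra.
have sum_b : \sum_(i < n) b i * D i = S.
  apply: eq_bigr => i _; rewrite /b mulrAC -normrEsg.
  by rewrite mulr_powRB1.
have b2_le i : b i ^+ 2 <= (`|D i| `^ q) `^ (1 - 2 * H).
  rewrite -powRrM (_ : q * (1 - 2 * H) = (q - 1) * 2); last first.
    have q_eq : q * (H + 1 / 2) = 1.
      by rewrite /q mul1r mulVf// gt_eqF ?addr_gt0.
    have -> (x : R) : x * (1 - 2 * H) = 2 * x - 2 * (x * (H + 1 / 2)) by field.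
    by rewrite q_eq mulrBl [q * 2]mulrC mul1r mulr1.
  rewrite powRrM powR_mulrn ?powR_ge0// exprMn ler_piMl ?sqr_ge0//.
  by rewrite sqr_sg lern1 leq_b1.
have S2_le : S ^+ 2 <=
    N * (2 * \sum_(i < n) (`|D i| `^ q) `^ (1 - 2 * H) * d i `^ (2 * H)).
  rewrite -[in leLHS]sum_b; have := fN n b tau (fun i => tau i.+1).
  move=> /le_trans; apply; apply: ler_wpM2l => //.
  apply: (le_trans (fbm_quadratic_form_le H_gt0 (ltW H_lt) b tau n tauS)).
  rewrite ler_wpM2l// ler_sum// => i _.
  by rewrite ler_wpM2r ?powR_ge0.
have hoelder : S `^ (2 * H) *
    \sum_(i < n) (`|D i| `^ q) `^ (1 - 2 * H) * d i `^ (2 * H) <= S.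
  rewrite mulr_sumr.
  apply: (@le_trans _ _
      (\sum_(i < n) ((1 - 2 * H) * `|D i| `^ q + 2 * H * (S * d i)))).
    apply: ler_sum => i _; have di_ge0 : 0 <= d i by exact: normr_ge0.
    rewrite mulrCA -powRM//.
    by apply: powR_weighted_AMGM; rewrite ?mulr_ge0 ?powR_ge0.
  rewrite big_split/= -!mulr_sumr -/S.
  have : 2 * H * (S * \sum_(i < n) d i) <= 2 * H * S.
    by rewrite ler_wpM2l ?(ltW H2_gt0)// ler_piMr.
  by lra.
have -> : S `^ (1 + 2 * H) = S * S `^ (2 * H).
  by rewrite powRD ?S_neq0 ?implybT// powRr1.
rewrite -(ler_pM2r S_gt0) mulrAC -expr2 mulrC.
apply: (le_trans (ler_wpM2l (powR_ge0 _ _) S2_le)).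
have -> (x y : R) : x * (N * (2 * y)) = 2 * N * (x * y) by ring.
by rewrite ler_wpM2l// mulr_ge0.
Qed.

End fbm_paths.

Lemma small_powR {R : realType} {C theta e : R} :
  0 <= C -> 0 < theta -> 0 < e ->
  exists2 d : R, 0 < d & forall x, 0 <= x -> x <= d -> C * x `^ theta <= e.
Proof.
move=> C0 theta0 e0; have C1 : 0 < C + 1 by rewrite ltr_wpDl.
exists ((e / (C + 1)) `^ theta^-1) => [|x x0 xd].
  by rewrite powR_gt0// divr_gt0.
have : x `^ theta <= e / (C + 1).
  have eC0 : 0 <= e / (C + 1) by rewrite divr_ge0 ?ltW.
  rewrite -[leRHS]powRr1// -[X in _ <= _ `^ X](mulVf (lt0r_neq0 theta0)) powRrM.
  by rewrite ge0_ler_powR ?nnegrE ?powR_ge0 ?(ltW theta0).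
rewrite ler_pdivlMr// mulrC; apply: le_trans.
by rewrite ler_wpM2r ?powR_ge0// lerDl.
Qed.

Lemma powR_split_le {R : realType} {a b x eta : R} :
  0 <= a -> a + b != 0 -> 0 <= x -> x <= eta ->
  x `^ (a + b) <= eta `^ a * x `^ b.
Proof.
move=> a0 ab x0 xeta; rewrite powRD ?(negPf ab)// ler_wpM2r ?powR_ge0//.
by rewrite ge0_ler_powR ?nnegrE// (le_trans x0).
Qed.

Lemma unit_partition_le {R : realType} {s : seq (unit_interval R)} {i : nat} :
  unit_partition s -> (i < size s)%N ->
  \val (nth unit_interval0 (unit_interval0 :: s) i) <=
  \val (nth unit_interval0 (unit_interval0 :: s) i.+1).
Proof.
move=> [+ _] si; move=> /(pathP 0) /(_ i); rewrite size_map => /(_ si) /ltW.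
rewrite -[X in nth 0 X i <= _](map_cons val unit_interval0).
by rewrite !(nth_map unit_interval0)//= ltnS ltnW.
Qed.

Section fbm_interpolation.
Context {R : realType} {H : R} (H_gt0 : 0 < H) (H_lt : H < 1 / 2).
Context {N : R} (N_ge0 : 0 <= N).

Lemma fbm_osc_le {f : unit_interval R -> R} s t :
  cov_bounded (@fbm_cov R H) N f -> `|f t - f s| <= Num.sqrt N.
Proof.
move=> /(fbm_holder H_gt0 N_ge0) /(_ s t) /le_trans; apply.
have st_le1 : `|\val t - \val s| <= 1.
  have := set_valP s; have := set_valP t; rewrite /= !in_itv/=.
  by rewrite ler_norml; lra.
rewrite ler_piMr ?sqrtr_ge0//; move: st_le1 (normr_ge0 (\val t - \val s)).
by move=> /(ge0_ler_powR (ltW H_gt0)); rewrite powR1 !nnegrE => le1 /le1; exact.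
Qed.

Lemma fbm_holder_seminorm_le {alpha : R} {f : unit_interval R -> R} {eta} :
  0 < alpha < H -> cov_bounded (@fbm_cov R H) N f ->
  (forall s t, `|f t - f s| <= eta) ->
  (holder_seminorm alpha f <=
    (Num.sqrt N `^ (alpha / H) * eta `^ (1 - alpha / H))%:E)%E.
Proof.
move=> /andP[alpha0 alphaH] fN f_eta; apply/holder_seminormP => s t _.
have aH : alpha / H < 1 by rewrite ltr_pdivrMr// mul1r.
have holder_st := fbm_holder H_gt0 N_ge0 fN s t.
have := @powR_split_le R (1 - alpha / H) (alpha / H) _ _ _ _ (normr_ge0 _)
  (f_eta s t).
rewrite subrK oner_eq0 powRr1 ?normr_ge0// subr_ge0 => /(_ (ltW aH) isT).
move=> /le_trans; apply; rewrite mulrAC [leRHS]mulrC ler_wpM2l ?powR_ge0//.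
have e : alpha = H * (alpha / H) by rewrite mulrCA mulfV ?mulr1// gt_eqF.
rewrite [X in _ <= _ * _ `^ X]e [X in _ <= _ * X]powRrM.
rewrite -powRM ?sqrtr_ge0 ?powR_ge0//.
have aH_ge0 : 0 <= alpha / H by rewrite divr_ge0// ltW.
by rewrite ge0_ler_powR// nnegrE ?mulr_ge0 ?sqrtr_ge0 ?powR_ge0.
Qed.

Lemma fbm_qvar_seminorm_le {q : R} {f : unit_interval R -> R} {eta} :
  1 / (H + 1 / 2) < q -> cov_bounded (@fbm_cov R H) N f ->
  (forall s t, `|f t - f s| <= eta) ->
  (qvar_seminorm q f <=
    (((2 * N) `^ (1 + 2 * H)^-1) `^ q^-1
      * eta `^ ((q - 1 / (H + 1 / 2)) / q))%:E)%E.
Proof.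
set q0 := 1 / (H + 1 / 2) => q0q fN f_eta; apply/qvar_seminormP => s ps.
have q0_gt0 : 0 < q0 by rewrite divr_gt0// addr_gt0.
have q_gt0 : 0 < q by exact: lt_trans q0q.
have eta_ge0 : 0 <= eta.
  by apply: le_trans (f_eta unit_interval0 unit_interval0).
rewrite powRrM -powRM ?powR_ge0// /qvariation big_mkord.
rewrite ge0_ler_powR ?nnegrE ?mulr_ge0 ?powR_ge0 ?invr_ge0 ?(ltW q_gt0)//.
  by rewrite sumr_ge0// => i _; exact: powR_ge0.
set tau := nth unit_interval0 (unit_interval0 :: s).
have := fbm_power_sum_le H_gt0 H_lt N_ge0 fN tau (size s)
  (fun i => unit_partition_le ps).
rewrite -/q0; set S := \sum_(i < size s) _ => S_le.
have H2_gt0 : 0 < 1 + 2 * H by rewrite addr_gt0// mulr_gt0.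
have S_ge0 : 0 <= S by rewrite sumr_ge0// => i _; exact: powR_ge0.
have {}S_le : S <= (2 * N) `^ (1 + 2 * H)^-1.
  rewrite -[leLHS]powRr1// -[X in _ `^ X](mulfV (lt0r_neq0 H2_gt0)) powRrM.
  by rewrite ge0_ler_powR ?nnegrE ?powR_ge0 ?mulr_ge0 ?invr_ge0 ?(ltW H2_gt0).
rewrite mulrC; apply: le_trans (ler_wpM2l (powR_ge0 _ _) S_le).
rewrite mulr_sumr; apply: ler_sum => i _ /=.
rewrite -[X in _ `^ X <= _](subrK q0).
by apply: powR_split_le; rewrite ?subr_ge0 ?(ltW q0q)// subrK gt_eqF.
Qed.

End fbm_interpolation.

Section rkhs_theory.
Context {R : realType} {T : Type} {K : T -> T -> R} (E : rkhs K).
Implicit Types u v : E.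

Lemma rkhs_dotC u v : rkhs_dot E u v = rkhs_dot E v u.
Proof. by rewrite hermC /= expr0 mul1r. Qed.

(* [linearZl_LR] and [linearZr_LR] also match products of scalars, read as
   [*:] on [R^o]. *)
Lemma rkhs_dotZl a u v : rkhs_dot E (a *: u) v = a * rkhs_dot E u v.
Proof. exact: linearZl_LR. Qed.

Lemma rkhs_dotZr a u v : rkhs_dot E u (a *: v) = a * rkhs_dot E u v.
Proof. exact: linearZr_LR. Qed.

Lemma rkhs_cauchy_schwarz u v :
  rkhs_dot E u v ^+ 2 <= rkhs_dot E u u * rkhs_dot E v v.
Proof.
have [->|v0] := eqVneq v 0; first by rewrite linear0r expr0n linear0r mulr0.
have vv_gt0 : 0 < rkhs_dot E v v by exact: neq0_dnorm_gt0.
have [c cvv] : exists c, c * rkhs_dot E v v = rkhs_dot E u v.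
  by exists (rkhs_dot E u v / rkhs_dot E v v); rewrite divfK// gt_eqF.
have : 0 <= rkhs_dot E (u - c *: v) (u - c *: v) by rewrite -rkhs_normE sqr_ge0.
rewrite linearBl !linearBr/= !rkhs_dotZl !rkhs_dotZr (rkhs_dotC v u).
rewrite -(pmulr_lge0 _ vv_gt0) -[_ ^+ 2 <= _]subr_ge0 -cvv.
by congr (0 <= _); ring.
Qed.

Lemma rkhs_cov_bounded (N : R) v :
  `|v| ^+ 2 <= N -> cov_bounded K N (rkhs_eval E v).
Proof.
move=> vN n b s t.
pose k i := rkhs_section E (t i) - rkhs_section E (s i).
pose w := \sum_(i < n) b i *: k i.
have dotk u i :
    rkhs_dot E u (k i) = rkhs_eval E u (t i) - rkhs_eval E u (s i).
  by rewrite linearBr/= !rkhs_reproducing.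
have -> : \sum_(i < n) b i * (rkhs_eval E v (t i) - rkhs_eval E v (s i)) =
    rkhs_dot E v w.
  by rewrite linear_sumr/=; apply: eq_bigr => i _; rewrite rkhs_dotZr dotk.
have -> : \sum_(i < n) \sum_(j < n)
    b i * b j * increment_cov K (s i) (t i) (s j) (t j) = rkhs_dot E w w.
  rewrite linear_sumlz; apply: eq_bigr => i _.
  rewrite linear_sumr/=; apply: eq_bigr => j _.
  rewrite rkhs_dotZl rkhs_dotZr mulrA; congr (_ * _).
  have evalk x : rkhs_eval E (k i) x = K (t i) x - K (s i) x.
    by rewrite linearB/= !rkhs_sectionE.
  by rewrite dotk !evalk /increment_cov; ring.
apply: (le_trans (rkhs_cauchy_schwarz v w)); rewrite -rkhs_normE.
by rewrite ler_wpM2r// -rkhs_normE sqr_ge0.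
Qed.

End rkhs_theory.

Lemma cameron_martin0 {R : realType} {H : R} (H_gt0 : 0 < H)
    (E : cameron_martin H) (v : E) : rkhs_eval E v unit_interval0 = 0.
Proof.
have k0 : rkhs_section E unit_interval0 = 0.
  apply: (rkhs_eval_inj (r := E)); rewrite rkhs_sectionE linear0.
  apply/funext => t; rewrite /fbm_cov/= subr0 ger0_norm.
    by rewrite powR0 ?add0r ?subrr ?mulr0// gt_eqF// mulr_gt0.
  by have := set_valP t; rewrite /= in_itv/= => /andP[].
by rewrite -rkhs_reproducing k0 linear0r.
Qed.

Lemma unit_interval_grid {R : realType} {d : R} : 0 < d ->
  exists n (g : 'I_n -> unit_interval R),
    forall t : unit_interval R, exists i, `|\val t - \val (g i)| <= d.
Proof.
move=> d0; pose m := (Num.trunc d^-1).+1.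
have m_gt0 : 0 < m%:R :> R by rewrite ltr0n.
have m_d : m%:R^-1 <= d.
  by rewrite -[leRHS]invrK lef_pV2 ?posrE ?invr_gt0// ltW// truncnS_gt.
have g_itv (i : 'I_m.+1) : (i%:R / m%:R : R) \in (`[0, 1]%classic : set R).
  rewrite inE/= in_itv/= divr_ge0//= ler_pdivrMr// mul1r ler_nat.
  by rewrite -ltnS ltn_ord.
exists m.+1, (fun i => SigSub (g_itv i)) => t.
have /andP[t0 t1] : 0 <= \val t <= 1.
  by have := set_valP t; rewrite /= in_itv.
have tm0 : 0 <= \val t * m%:R by rewrite mulr_ge0// ltW.
have /andP[le_tm lt_tm] := truncn_itv tm0.
have ltm : (Num.trunc (\val t * m%:R) < m.+1)%N.
  by rewrite ltnS -(ler_nat R) (le_trans le_tm)// ler_piMl// ltW.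
exists (Ordinal ltm); rewrite /= (le_trans _ m_d)//.
rewrite -[X in `|X - _|](mulfK (lt0r_neq0 m_gt0)) -mulrBl normrM.
rewrite [X in _ * X]ger0_norm ?invr_ge0 ?(ltW m_gt0)//.
rewrite ler_piMl ?invr_ge0 ?(ltW m_gt0)//.
by rewrite ger0_norm ?subr_ge0// lerBlDl natr1 ltW.
Qed.

Definition fbm_ball {R : realType} (H N : R) :
    set (prod_topology (fun _ : unit_interval R => R)) :=
  [set f | f unit_interval0 = 0 /\ cov_bounded (@fbm_cov R H) N f].

Lemma continuous_dist_leP {R : realType} {S : topologicalType} {p : S -> R} :
  continuous p <->
  forall x e, 0 < e -> \forall y \near x, `|p x - p y| <= e.
Proof.
split=> cp x; last by apply/cvgrPdist_le => e; exact: cp.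
by move=> e e0; move/cvgrPdist_le : (cp x); exact.
Qed.

Lemma pointwise_eval_continuous {R : realType} {T : choiceType} (t : T) :
  continuous (fun f : prod_topology (fun _ : T => R) => f t).
Proof. exact: (@proj_continuous _ (fun _ : T => R) t). Qed.

Lemma fbm_ball_closed {R : realType} (H N : R) : closed (fbm_ball H N).
Proof.
pose P := prod_topology (fun _ : unit_interval R => R).
pose C := (nat * (nat -> R) * (nat -> unit_interval R)
  * (nat -> unit_interval R))%type.
pose lin (c : C) (f : P) :=
  \sum_(i < c.1.1.1) c.1.1.2 i * (f (c.2 i) - f (c.1.2 i)).
pose var (c : C) := \sum_(i < c.1.1.1) \sum_(j < c.1.1.1)
  c.1.1.2 i * c.1.1.2 j
  * increment_cov (@fbm_cov R H) (c.1.2 i) (c.2 i) (c.1.2 j) (c.2 j).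
have -> : fbm_ball H N = [set f : P | f unit_interval0 = 0] `&`
    \bigcap_(c in [set: C]) (lin c @^-1` [set x | x ^+ 2 <= N * var c]).
  apply/seteqP; split=> f [f0 fN]; split=> //.
    by move=> [[[n b] u] v] _; exact: fN.
  by move=> n b u v; exact: (fN (n, b, u, v)).
apply: closedI.
  by apply: (preimage_closed (D := [set x | x = 0])) => [? _|];
    [exact: pointwise_eval_continuous|exact: closed_eq].
apply: closed_bigI => c _; apply: preimage_closed => [f _|].
  apply: continuous_big => [|i _ {}f]; first exact: add_continuous.
  have scaleB_continuous (S : topologicalType) (a : R) (p r : S -> R) :
      continuous p -> continuous r -> continuous (fun x => a * (p x - r x)).
    move=> cp cr x; apply: cvgM; first exact: cvg_cst.
    by apply: cvgB; [exact: cp|exact: cr].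
  by apply: (scaleB_continuous P); exact: pointwise_eval_continuous.
apply: (preimage_closed (f := fun x : R => x ^+ 2)
  (D := [set x | x <= N * var c])).
  by move=> x _; exact: exprn_continuous.
exact: closed_le.
Qed.

Lemma fbm_ball_compact {R : realType} {H N : R} :
  0 < H -> 0 <= N -> compact (fbm_ball H N).
Proof.
move=> H_gt0 N_ge0; apply: (subclosed_compact (fbm_ball_closed H N)).
  apply: (@tychonoff _ (fun _ : unit_interval R => R)
    (fun=> `[- Num.sqrt N, Num.sqrt N]%classic)) => _.
  exact: segment_compact.
move=> f [f0 fN] t; rewrite /= in_itv/= -ler_norml.
by have := fbm_osc_le H_gt0 N_ge0 unit_interval0 t fN; rewrite f0 subr0.
Qed.

Section cameron_martin_embedding.
Context {R : realType} {H : R} (H_gt0 : 0 < H) (E : cameron_martin H).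
Context {W : normedModType R} (ev : W -> unit_interval R -> R).
Context (ev_inj : injective ev).
Context (ev_linear : forall a x y, ev (a *: x + y) = a *: ev x + ev y).
Context (ev_onto : forall (N : R) f,
  0 <= N -> cov_bounded (@fbm_cov R H) N f -> exists w, ev w = f).
Context (ev_small : forall N e : R, 0 <= N -> 0 < e ->
  exists2 eta : R, 0 < eta & forall w, cov_bounded (@fbm_cov R H) N (ev w) ->
    (forall t, `|ev w t| <= eta) -> `|w| <= e).

Let lift (f : unit_interval R -> R) : W := xget 0 [set w | ev w = f].

Let liftK (N : R) f :
  0 <= N -> cov_bounded (@fbm_cov R H) N f -> ev (lift f) = f.
Proof. by move=> N0 fN; have := xgetPex 0 (ev_onto _ _ N0 fN). Qed.

Let evB x y : ev (x - y) = ev x - ev y.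
Proof. by rewrite addrC -scaleN1r ev_linear scaleN1r addrC. Qed.

(* On the ball pointwise and uniform convergence agree by equicontinuity, and
   differences stay in the ball of four times the radius, so [ev_small] turns
   uniform smallness into smallness in [W]. *)
Lemma fbm_ball_lift_continuous (N : R) : 0 <= N ->
  {within fbm_ball H N, continuous lift}.
Proof.
move=> N0; apply/subspace_continuousP => f [f0 fN].
apply/cvgrPdist_le => e e0.
have N4 : 0 <= 4 * N by rewrite mulr_ge0.
have [eta eta0 small] := ev_small _ _ N4 e0.
have eta2 : 0 < eta / 2 by rewrite divr_gt0.
have [d d0 dP] := small_powR (sqrtr_ge0 (4 * N)) H_gt0 eta2.
have [n [g gP]] := unit_interval_grid d0.
pose P := prod_topology (fun _ : unit_interval R => R).
have near_grid :
    \forall h \near (f : P), forall i, `|f (g i) - h (g i)| <= eta / 2.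
  apply: (@filter_forall P 'I_n _ (nbhs (f : P)) _) => i.
  exact: (continuous_dist_leP.1 (pointwise_eval_continuous (g i)) f _ eta2).
rewrite near_withinE.
move: near_grid; apply: (@filterS P (nbhs (f : P)) _) => h hg [_ hN].
have fhN := cov_boundedB fN hN.
have evfh : ev (lift f - lift h) = f - h by rewrite evB !(liftK _ _ N0).
apply: small; rewrite evfh // => t; have [i ti] := gP t.
have := fbm_holder H_gt0 N4 fhN (g i) t.
move=> /le_trans /(_ (dP _ (normr_ge0 _) ti)) le1.
rewrite -[(f - h) t](subrK ((f - h) (g i))) (le_trans (ler_normD _ _))//.
by rewrite [leRHS](splitr eta) lerD//; exact: hg.
Qed.

Lemma cameron_martin_compactly_embedded : compactly_embedded (rkhs_eval E) ev.
Proof.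
have ev_lift v : ev (lift (rkhs_eval E v)) = rkhs_eval E v.
  by apply: (liftK (`|v| ^+ 2)); [exact: sqr_ge0|exact: rkhs_cov_bounded].
pose i v := lift (rkhs_eval E v).
have i_linear : linear i.
  by move=> a u v; apply: ev_inj; rewrite ev_linear !ev_lift linearP.
pose iL : {linear E -> W} :=
  HB.pack i (GRing.isLinear.Build R E W *:%R i i_linear).
exists iL => // A.
move=> [M [_ /(_ (`|M| + 1))]].
rewrite (le_lt_trans (ler_norm M)) ?ltrDl// => /(_ isT) AM.
pose N := (`|M| + 1) ^+ 2.
have N0 : 0 <= N by exact: sqr_ge0.
have cK := continuous_compact (fbm_ball_lift_continuous _ N0)
  (fbm_ball_compact H_gt0 N0).
exists (lift @` fbm_ball H N).
  move=> _ [v Av <-]; exists (rkhs_eval E v) => //.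
  split; first exact: cameron_martin0.
  by apply: rkhs_cov_bounded; rewrite ler_pXn2r ?nnegrE ?addr_ge0//; exact: AM.
by split=> //; apply: compact_closed => //; exact: norm_hausdorff.
Qed.

End cameron_martin_embedding.

Lemma path_norm_le {R : realType} {Q : (unit_interval R -> R) -> \bar R}
    {h : unit_interval R -> R} {A B : R} :
  path_seminorm Q -> (forall t, `|h t| <= A) -> (Q h <= B%:E)%E ->
  path_norm Q h <= A + B.
Proof.
move=> Qsemi /sup_normP hA hB; rewrite /path_norm lerD// -lee_fin fineK//.
  rewrite ge0_fin_numE ?(le_lt_trans hA) ?ltry//.
  exact: path_seminorm_ge0 sup_norm_seminorm h.
by rewrite ge0_fin_numE ?(le_lt_trans hB) ?ltry// path_seminorm_ge0.
Qed.

Lemma path_norm_small {R : realType} {Q : (unit_interval R -> R) -> \bar R}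
    {F : set (unit_interval R -> R)} {C theta e : R} :
  path_seminorm Q -> 0 <= C -> 0 < theta ->
  (forall f eta, F f -> (forall s t, `|f t - f s| <= eta) ->
    (Q f <= (C * eta `^ theta)%:E)%E) ->
  0 < e -> exists2 eta, 0 < eta &
    forall f, F f -> (forall t, `|f t| <= eta) -> path_norm Q f <= e.
Proof.
move=> Qsemi C0 theta0 Q_le e0; have e2 : 0 < e / 2 by rewrite divr_gt0.
have [d d0 dP] := small_powR C0 theta0 e2.
exists (Num.min (d / 2) (e / 2)) => [|f Ff].
  by rewrite lt_min e2 divr_gt0.
set eta := Num.min _ _ => f_eta.
have eta_d : eta <= d / 2 by rewrite ge_min lexx.
have eta_e : eta <= e / 2 by rewrite ge_min lexx orbT.
rewrite (splitr e) (path_norm_le Qsemi)// => [t|].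
  exact: le_trans (f_eta t) eta_e.
apply: (le_trans (Q_le f d Ff _)) => [s t|].
  rewrite (le_trans (ler_normB _ _))// (splitr d) lerD//.
    exact: le_trans (f_eta t) eta_d.
  exact: le_trans (f_eta s) eta_d.
by rewrite lee_fin dP// ltW.
Qed.

Lemma fbm_continuous {R : realType} {H N : R} {f : unit_interval R -> R} :
  0 < H -> 0 <= N -> cov_bounded (@fbm_cov R H) N f -> continuous f.
Proof.
move=> H_gt0 N_ge0 fN; apply/continuous_dist_leP => t e e0.
have [d d0 dP] := small_powR (sqrtr_ge0 N) H_gt0 e0.
have near_d : \forall s \near t, `|\val t - \val s| <= d.
  exact: (continuous_dist_leP.1 (@initial_continuous _ _ set_val) t _ d0).
apply: filterS near_d => s sd.
by apply: (le_trans (fbm_holder H_gt0 N_ge0 fN s t)); exact: dP.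
Qed.

Theorem corollary1 (R : realType) (H : R) (H_gt0 : 0 < H) (H_lt : H < 1 / 2)
    (E : cameron_martin H)
    (alpha : R) (alpha_gt0 : 0 < alpha) (alpha_lt : alpha < H)
    (q : R) (q_gt : 1 / (H + 1 / 2) < q) :
  compactly_embedded (rkhs_eval E)
    (@holder_fun R alpha (ltW alpha_gt0))
  /\
  compactly_embedded (rkhs_eval E)
    (@qvar_fun R q (qvar_exponent_ge1 H_gt0 H_lt q_gt)).
Proof.
have alpha_itv : 0 < alpha < H by rewrite alpha_gt0.
have q_ge1 := qvar_exponent_ge1 H_gt0 H_lt q_gt.
have q_gt0 : 0 < q by rewrite (lt_le_trans ltr01).
split; apply: cameron_martin_compactly_embedded => //.
- exact: val_inj.
- move=> N f N0 fN.
  have Qf := fbm_holder_seminorm_le H_gt0 N0 alpha_itv fN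
    (fun s t => fbm_osc_le H_gt0 N0 s t fN).
  have f_in : f \in holder_pred (ltW alpha_gt0).
    by rewrite inE/=; apply: le_lt_trans Qf (ltry _).
  by exists (HolderPath f_in).
- move=> N e N0 e0.
  have theta_gt0 : 0 < 1 - alpha / H by rewrite subr_gt0 ltr_pdivrMr// mul1r.
  have [eta eta0 small] := path_norm_small (F := cov_bounded (@fbm_cov R H) N)
    (holder_seminorm_seminorm alpha) (powR_ge0 (Num.sqrt N) (alpha / H))
    theta_gt0
    (fun f eta => fbm_holder_seminorm_le H_gt0 N0 alpha_itv) e0.
  by exists eta => // w wN w_eta; exact: small.
- exact: val_inj.
- move=> N f N0 fN.
  have Qf := fbm_qvar_seminorm_le H_gt0 H_lt N0 q_gt fN
    (fun s t => fbm_osc_le H_gt0 N0 s t fN).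
  have f_in : f \in qvar_pred (qvar_exponent_ge1 H_gt0 H_lt q_gt).
    rewrite inE/=; split; first exact: fbm_continuous fN.
    by apply: le_lt_trans Qf (ltry _).
  by exists (QvarPath f_in).
- move=> N e N0 e0.
  have theta_gt0 : 0 < (q - 1 / (H + 1 / 2)) / q by rewrite divr_gt0// subr_gt0.
  have [eta eta0 small] := path_norm_small (F := cov_bounded (@fbm_cov R H) N)
    (qvar_seminorm_seminorm q_ge1) (powR_ge0 _ q^-1)
    theta_gt0
    (fun f eta => fbm_qvar_seminorm_le H_gt0 H_lt N0 q_gt) e0.
  by exists eta => // w wN w_eta; exact: small.
Qed.
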